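(* The policy iteration algorithm RMDP-PI for Problem DiscRMDP (with discount factor $\gamma$, on a robust Markov decision process with $n$ states and $m$ actions) requires $$O\!\left(n\,m\,\frac{\log(1-\gamma)}{\log\gamma}\right)$$ (i.e., strongly polynomial for constant discount factor) iterations and solutions of Problem DiscRMC, for any compact uncertainty sets.
   Context: A robust Markov decision process (RMDP) is a tuple $\mathcal R=(\mathcal S,c,\mathcal A,\mathrm{Succ},\mathcal P)$ with finite state set $\mathcal S$ ($|\mathcal S|=n$), finite action set $\mathcal A$ ($|\mathcal A|=m$), cost $c:\mathcal S\to\mathbb R$, successor map $\mathrm{Succ}:\mathcal S\times\mathcal A\to 2^{\mathcal S}$, and for each $(s,a)$ a non-empty compact uncertainty set $\mathcal P(s,a)\subseteq\Delta(\mathrm{Succ}(s,a))$ of probability distributions. At each step in state $s$, the agent picks an action $a$, then the adversary, seeing $a$, picks $\mathfrak p\in\mathcal P(s,a)$, and the next state is drawn from $\mathfrak p$. The cost of a run $s_0,a_0,s_1,\dots$ is $\sum_{t\ge0}\gamma^t c(s_t)$; the agent minimizes and the adversary maximizes its expectation. Positional policies suffice for both: an agent policy is $\sigma:\mathcal S\to\mathcal A$, an adversary policy is $\tau:\mathcal S\times\mathcal A\to\Delta(\mathcal S)$ with $\tau(s,a)\in\mathcal P(s,a)$. The value is $v^*(s)=\inf_\sigma\sup_\tau\mathbb E_s^{\sigma,\tau}[\sum_t\gamma^tc(s_t)]$. An agent policy $\sigma^*$ is optimal if $\sup_\tau\mathbb E_s^{\sigma^*,\tau}[\sum_t\gamma^tc(s_t)]=v^*(s)$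 for every state $s$; optimal adversary policies are defined analogously. A robust Markov chain (RMC) is an RMDP with a single action (dropped from the notation, so the uncertainty sets are $\mathcal P(s)$). Problem DiscRMDP: given an RMDP with a constant discount factor $\gamma\in[0,1)$, compute the value vector $v^*$, an optimal agent policy and an optimal adversary policy. Problem DiscRMC: given an RMC with a constant discount factor $\gamma\in[0,1)$, compute the value vector and an optimal adversary policy. Algorithm RMDP-PI: start with an arbitrary agent policy $\sigma^0$, $t=0$. Repeat: (i) let $\tau^t$ be the adversary policy returned by an oracle for Problem DiscRMC on the RMC $\mathcal R^{\sigma^t}$ obtained by fixing $\sigma^t$; (ii) $v^t=(I-\gamma P^{\sigma^t,\tau^t})^{-1}c$, where $P^{\sigma,\tau}$ is the transition matrix induced by $\sigma,\tau$; (iii) $t\leftarrow t+1$; (iv) for all $s\in\mathcal S$, $\sigma^t(s)\leftarrow\arg\min_{a\in\mathcal A}\max_{\mathfrak p\in\mathcal P(s,a)}\{c(s)+\gamma\,\mathfrak p^\top v^{t-1}\}$; until $\sigma^t=\sigma^{t-1}$. Return $\sigma^t$. An algorithm is strongly polynomial if both the number of arithmetic operations it performs and the size of intermediate values are bounded by a polynomial in the input size, independent of the numerical values of the coefficients.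
   Formalization: The factor log(1-γ)/log γ is replaced by max(1, log(1-γ)/log γ), since it tends to 0 as γ→0 (undefined at γ=0) while at least one iteration always runs; ties in arg min are broken by a stable rule, since arbitrary tie-breaking can cycle forever. *)

(* Defs.v *)
(* MathComp / MathComp-Analysis *)
From HB Require Import structures.
From mathcomp Require Import all_boot all_order all_algebra.
From mathcomp Require Import all_classical all_reals all_analysis.

Set Implicit Arguments.
Unset Strict Implicit.
Unset Printing Implicit Defensive.

Import Order.TTheory GRing.Theory Num.Theory.
Import numFieldNormedType.Exports.

Local Open Scope classical_set_scope.
Local Open Scope ring_scope.

Definition prob_simplex (R : realType) (n : nat) (B : {set 'I_n}) :
    set 'rV[R]_n :=
  [set p | [/\ forall i, 0 <= p 0 i, \sum_i p 0 i = 1 &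
               forall i, i \notin B -> p 0 i = 0]].

Record rmdp (R : realType) (n m : nat) := RMDP {
  cost : 'cV[R]_n;
  succ : 'I_n -> 'I_m -> {set 'I_n};
  uncertainty : 'I_n -> 'I_m -> set 'rV[R]_n;
  uncertainty_nonempty : forall s a, uncertainty s a !=set0;
  uncertainty_compact : forall s a, compact (uncertainty s a);
  uncertainty_distr :
    forall s a, uncertainty s a `<=` prob_simplex (succ s a)
}.

Notation agent_policy n m := {ffun 'I_n -> 'I_m}.
Notation adversary_policy R n m := ('I_n -> 'I_m -> 'rV[R]_n).

Definition admissible (R : realType) (n m : nat) (M : rmdp R n m)
    (tau : adversary_policy R n m) : Prop :=
  forall s a, uncertainty M s a (tau s a).

Definition transition_mx (R : realType) (n m : nat)
    (sigma : agent_policy n m) (tau : adversary_policy R n m) : 'M[R]_n :=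
  \matrix_(s, s') tau s (sigma s) 0 s'.

(* Probability that the chain started in [s] next visits the states of [w]. *)
Fixpoint path_prob (R : realType) (n : nat) (P : 'M[R]_n)
    (s : 'I_n) (w : seq 'I_n) : R :=
  if w is s' :: w' then P s s' * path_prob P s' w' else 1.

Definition path_cost (R : realType) (n : nat) (c : 'cV[R]_n) (gamma : R)
    (s : 'I_n) (w : seq 'I_n) : R :=
  \sum_(t < (size w).+1) gamma ^+ t * c (nth s (s :: w) t) 0.

(* Expectation of the discounted cost of the run started in [s]: the limit of
   the expected costs of its first [N] steps. As [c] is bounded and
   [0 <= gamma < 1], the truncated costs converge uniformly over all runs, so
   this limit is the expectation of the cost of the infinite run. *)
Definition expected_cost (R : realType) (n m : nat) (M : rmdp R n m)
    (gamma : R) (sigma : agent_policy n m) (tau : adversary_policy R n m)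
    (s : 'I_n) : R :=
  limn (fun N : nat => \sum_(w : N.-tuple 'I_n)
    path_prob (transition_mx sigma tau) s w * path_cost (cost M) gamma s w).

Definition worst_cost (R : realType) (n m : nat) (M : rmdp R n m) (gamma : R)
    (sigma : agent_policy n m) (s : 'I_n) : R :=
  sup [set expected_cost M gamma sigma tau s | tau in admissible M].

Definition best_cost (R : realType) (n m : nat) (M : rmdp R n m) (gamma : R)
    (tau : adversary_policy R n m) (s : 'I_n) : R :=
  inf [set expected_cost M gamma sigma tau s
      | sigma in [set: agent_policy n m]].

Definition value (R : realType) (n m : nat) (M : rmdp R n m) (gamma : R)
    (s : 'I_n) : R :=
  inf [set worst_cost M gamma sigma s | sigma in [set: agent_policy n m]].

Definition optimal_agent (R : realType) (n m : nat) (M : rmdp R n m)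
    (gamma : R) (sigma : agent_policy n m) : Prop :=
  forall s, worst_cost M gamma sigma s = value M gamma s.

Definition optimal_adversary (R : realType) (n m : nat) (M : rmdp R n m)
    (gamma : R) (tau : adversary_policy R n m) : Prop :=
  admissible M tau /\ forall s, best_cost M gamma tau s = value M gamma s.

(* A robust Markov chain is an RMDP whose only action is [ord0 : 'I_1]. *)
Notation rmc R n := (rmdp R n 1).

Definition fix_agent (R : realType) (n m : nat) (M : rmdp R n m)
    (sigma : agent_policy n m) : rmc R n :=
  {| cost := cost M;
     succ := fun s _ => succ M s (sigma s);
     uncertainty := fun s _ => uncertainty M s (sigma s);
     uncertainty_nonempty := fun s _ => uncertainty_nonempty M s (sigma s);
     uncertainty_compact := fun s _ => @uncertainty_compact R n m M s (sigma s);
     uncertainty_distr := fun s _ => @uncertainty_distr R n m M s (sigma s)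
  |}.

(* The transition matrix of the RMC obtained by fixing an agent policy, under
   the adversary policy [tau] of that RMC. *)
Definition rmc_transition_mx (R : realType) (n : nat)
    (tau : adversary_policy R n 1) : 'M[R]_n :=
  transition_mx [ffun=> ord0] tau.

(* The supremum is a maximum, since the uncertainty sets are compact. *)
Definition robust_backup (R : realType) (n m : nat) (M : rmdp R n m)
    (gamma : R) (v : 'cV[R]_n) (s : 'I_n) (a : 'I_m) : R :=
  sup [set cost M s 0 + gamma * (p *m v) 0 0 | p in uncertainty M s a].

Definition greedy_actions (R : realType) (n m : nat) (M : rmdp R n m)
    (gamma : R) (v : 'cV[R]_n) (s : 'I_n) : {set 'I_m} :=
  [set a | [forall b, robust_backup M gamma v s a
                      <= robust_backup M gamma v s b]]%SET.

(* How "arg min" selects one minimizer: [pick s a B] is the action chosen in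
   state [s] when [a] is the current action and [B] the set of minimizers.
   The second clause (an unchanged [B] leaves the choice unchanged) is needed
   for the stopping test to be reachable when minimizers are not unique; it
   holds for any fixed choice function of [B], and for the rule that keeps
   the current action whenever it is a minimizer. *)
Definition tie_breaking (n m : nat)
    (pick : 'I_n -> 'I_m -> {set 'I_m} -> 'I_m) : Prop :=
  forall s a (B : {set 'I_m}), B != finset.set0 ->
    pick s a B \in B /\ pick s (pick s a B) B = pick s a B.

(* The sequences computed by policy iteration, not stopping at its exit test.
   Each index [t] stands for one iteration and one solution [tau t], by an
   oracle, of the discounted problem on the RMC obtained by fixing [sigma t]. *)
Record policy_iteration (R : realType) (n m : nat) (M : rmdp R n m) (gamma : R)
    (pick : 'I_n -> 'I_m -> {set 'I_m} -> 'I_m)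
    (sigma : nat -> agent_policy n m)
    (tau : nat -> adversary_policy R n 1)
    (v : nat -> 'cV[R]_n) : Prop := PolicyIteration {
  pi_oracle : forall t,
    optimal_adversary (fix_agent M (sigma t)) gamma (tau t);
  pi_evaluation : forall t,
    v t = invmx (1%:M - gamma *: rmc_transition_mx (tau t)) *m cost M;
  pi_improvement : forall t s,
    sigma t.+1 s = pick s (sigma t s) (greedy_actions M gamma (v t) s)
}.

(* The exit test "sigma^t = sigma^(t-1)" first succeeds after [T] iterations. *)
Definition stops_after (n m : nat) (sigma : nat -> agent_policy n m)
    (T : nat) : Prop :=
  [/\ (0 < T)%N, sigma T = sigma T.-1 &
      forall t, (0 < t < T)%N -> sigma t <> sigma t.-1].

(* Main.v *)
Require Import Defs.
From mathcomp Require Import all_boot all_order all_algebra.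
From mathcomp Require Import all_classical all_reals all_analysis.
From mathcomp Require Import ring lra.

Set Implicit Arguments.
Unset Strict Implicit.
Unset Printing Implicit Defensive.

Import Order.TTheory GRing.Theory Num.Theory.
Import numFieldNormedType.Exports.
Local Open Scope classical_set_scope.
Local Open Scope ring_scope.

(* For an agent policy sigma let T_sigma be its robust backup operator, a
   monotone gamma-contraction whose fixed point is the value of sigma against
   the worst adversary; let w be the fixed point of T = min_sigma T_sigma.
   Policy iteration yields v^(t+1) <= T v^t <= v^t, hence
   |v^(t+k) - w| <= gamma^k |v^t - w|.  Moreover
     T_sigma w - w <= v_sigma - w   and   |v_sigma - w| <= |T_sigma w - w| / (1 - gamma).
   Let s be a state where T_(sigma^t) w - w is maximal, and positive since
   sigma^t is not optimal.  If sigma^(t+k) chose the same action in s, then this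
   maximum would be at most gamma^k / (1 - gamma) times itself.  So once
   gamma^K < 1 - gamma, every K iterations discard one of the n m state-action
   pairs for good. *)

(** Take for [e] the largest entry of [d]: if positive, it is at most [gamma] times itself plus [a];
    otherwise [0 <= a] suffices. *)
Lemma contraction_bound (R : realType) (n : nat) (gamma a : R)
    (d : 'I_n -> R) :
  0 <= gamma < 1 -> 0 <= a ->
  (forall e, 0 <= e -> (forall s, d s <= e) -> forall s, d s <= gamma * e + a) ->
  forall s, d s <= a / (1 - gamma).
Proof.
move=> /andP[g0 g1] a0 H s.
have g1' : 0 < 1 - gamma by rewrite subr_gt0.
case: (@arg_maxP _ _ _ s xpredT d isT) => s1 _ Hm.
apply: (le_trans (Hm s isT)); have [d0|d0] := leP (d s1) 0.
  by apply: (le_trans d0); rewrite divr_ge0 // ltW.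
have := H (d s1) (ltW d0) (fun s => Hm s isT) s1.
by rewrite ler_pdivlMr // => ?; lra.
Qed.

Lemma mx_subE (V : zmodType) (p q : nat) (A B : 'M[V]_(p, q)) i j :
  (A - B) i j = A i j - B i j.
Proof. by rewrite !mxE. Qed.

Lemma mx_oppE (V : zmodType) (p q : nat) (A : 'M[V]_(p, q)) i j :
  (- A) i j = - A i j.
Proof. by rewrite mxE. Qed.

(** * Discounted cost of a finite Markov chain *)

Section StochasticMatrix.
Context {R : realType} {n : nat}.
Implicit Types (P : 'M[R]_n) (u x c : 'cV[R]_n).

Definition stochastic P :=
  (forall s s', 0 <= P s s') /\ forall s, \sum_s' P s s' = 1.

Lemma stochastic_le P u e s :
  stochastic P -> (forall s', u s' 0 <= e) -> (P *m u) s 0 <= e.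
Proof.
move=> [P0 P1] ue; rewrite mxE.
apply: (@le_trans _ _ (\sum_j P s j * e)); last by rewrite -mulr_suml P1 mul1r.
by apply: ler_sum => j _; rewrite ler_wpM2l.
Qed.

Lemma stochastic_subinvariant P gamma u :
  stochastic P -> 0 <= gamma < 1 ->
  (forall s, u s 0 <= gamma * (P *m u) s 0) -> forall s, u s 0 <= 0.
Proof.
move=> sP g01 H s; rewrite -(mul0r (1 - gamma)^-1).
apply: (@contraction_bound _ _ gamma _ (fun s => u s 0)) => // e e0 ue s1.
case/andP: g01 => g0 _.
by rewrite addr0 (le_trans (H s1)) // ler_wpM2l // stochastic_le.
Qed.

Lemma discounted_unitmx P gamma :
  stochastic P -> 0 <= gamma < 1 -> 1%:M - gamma *: P \in unitmx.
Proof.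
(* Transposing turns the row kernel into column vectors [x = gamma *: (P *m x)]; both [x] and [- x]
   are then subinvariant, so [x = 0]. *)
move=> sP g01; rewrite -unitmx_tr -row_free_unit -kermx_eq0.
apply/rowV0P => v /sub_kermxP /(congr1 trmx).
rewrite trmx_mul trmxK trmx0; set x := v^T => xE.
have {}xE : x = gamma *: (P *m x).
  by apply/eqP; rewrite -subr_eq0 -xE mulmxBl mul1mx scalemxAl.
have xs s : x s 0 = gamma * (P *m x) s 0 by rewrite [in LHS]xE mxE.
have x0 : x = 0.
  apply/colP => s; rewrite [RHS]mxE; apply/eqP; rewrite eq_le; apply/andP; split.
    by apply: (stochastic_subinvariant sP g01) => s'; rewrite -xs.
  rewrite -oppr_le0 -mx_oppE.
  apply: (stochastic_subinvariant sP g01) => s'.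
  by rewrite mulmxN !mx_oppE mulrN -xs.
by rewrite -[v]trmxK -/x x0 trmx0.
Qed.

Definition discounted_cost P gamma c := invmx (1%:M - gamma *: P) *m c.

Lemma discounted_costE P gamma c s :
  stochastic P -> 0 <= gamma < 1 ->
  discounted_cost P gamma c s 0 =
  c s 0 + gamma * (P *m discounted_cost P gamma c) s 0.
Proof.
move=> sP g01; set x := discounted_cost _ _ _.
have : (1%:M - gamma *: P) *m x = c.
  by rewrite mulmxA mulmxV ?mul1mx // discounted_unitmx.
rewrite mulmxBl mul1mx -scalemxAl => <-.
by rewrite !mxE; ring.
Qed.

(** Subtracting the fixed point equation of the discounted cost makes the difference with [u]
    subinvariant. *)
Lemma le_discounted_cost P gamma c u :
  stochastic P -> 0 <= gamma < 1 ->
  (forall s, u s 0 <= c s 0 + gamma * (P *m u) s 0) ->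
  forall s, u s 0 <= discounted_cost P gamma c s 0.
Proof.
move=> sP g01 uP s; set x := discounted_cost _ _ _.
rewrite -subr_le0 -mx_subE; apply: (@stochastic_subinvariant P gamma) => // s'.
have xE : x s' 0 = c s' 0 + gamma * (P *m x) s' 0 by exact: discounted_costE.
by rewrite mulmxBr !mx_subE xE; have := uP s'; lra.
Qed.

Lemma discounted_cost_le P gamma c u :
  stochastic P -> 0 <= gamma < 1 ->
  (forall s, c s 0 + gamma * (P *m u) s 0 <= u s 0) ->
  forall s, discounted_cost P gamma c s 0 <= u s 0.
Proof.
move=> sP g01 uP s.
rewrite -lerN2 -!mx_oppE -mulmxN; apply: le_discounted_cost => // s'.
by rewrite mulmxN !mx_oppE; have := uP s'; lra.
Qed.

Lemma path_cost_cons c gamma s s' w :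
  path_cost c gamma s (s' :: w) = c s 0 + gamma * path_cost c gamma s' w.
Proof.
rewrite /path_cost big_ord_recl expr0 mul1r mulr_sumr; congr (_ + _).
apply: eq_bigr => i _; rewrite lift0 exprS mulrA /=.
by rewrite (set_nth_default s').
Qed.

Lemma sum_cons_tuple (N : nat) (F : seq 'I_n -> R) :
  \sum_(w : N.+1.-tuple 'I_n) F w = \sum_s \sum_(w : N.-tuple 'I_n) F (s :: w).
Proof.
rewrite pair_big /=.
rewrite (reindex (fun p : 'I_n * N.-tuple 'I_n => [tuple of p.1 :: p.2])) //=.
exists (fun w : N.+1.-tuple 'I_n => (thead w, [tuple of behead w])).
  by move=> [s w] _ /=; rewrite theadE; congr pair; apply: val_inj.
by move=> w _; rewrite /= [RHS]tuple_eta.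
Qed.

Lemma sum_path_prob P N s :
  stochastic P -> \sum_(w : N.-tuple 'I_n) path_prob P s w = 1.
Proof.
move=> [P0 P1]; elim: N s => [|N IH] s.
  rewrite (big_pred1 [tuple]) // => w.
  by rewrite /= (tuple0 w); apply/esym/eqP.
rewrite (sum_cons_tuple N (path_prob P s)) /= -[RHS](P1 s).
by apply: eq_bigr => s' _; rewrite -mulr_sumr IH mulr1.
Qed.

(** The expectations whose limit defines [expected_cost], gathered in a column so that first-step
    analysis becomes a product with [P]. *)
Definition truncated_cost P gamma c N : 'cV[R]_n :=
  \col_s \sum_(w : N.-tuple 'I_n) path_prob P s w * path_cost c gamma s w.

(** Condition on the first transition: the probabilities of the remaining paths sum to 1, so the
    immediate cost factors out. *)
Lemma truncated_cost_rec P gamma c N s : stochastic P ->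
  truncated_cost P gamma c N.+1 s 0 =
  c s 0 + gamma * (P *m truncated_cost P gamma c N) s 0.
Proof.
move=> sP; rewrite !mxE.
rewrite (sum_cons_tuple N (fun w => path_prob P s w * path_cost c gamma s w)).
under eq_bigr => s' _ do under eq_bigr => w _ do
  rewrite path_cost_cons /= mulrDr.
under eq_bigr => s' _ do rewrite big_split /= -mulr_suml -mulr_sumr
  sum_path_prob // mulr1.
rewrite big_split /= -mulr_suml sP.2 mul1r; congr (_ + _).
rewrite mulr_sumr; apply: eq_bigr => s' _; rewrite mxE !mulr_sumr.
by apply: eq_bigr => w _; ring.
Qed.

(** Both sides obey the same affine recursion, so the error shrinks by [gamma] at each step. *)
Lemma truncated_cost_cvg P gamma c s : stochastic P -> 0 <= gamma < 1 ->
  (fun N => truncated_cost P gamma c N s 0) @ \oo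
    --> discounted_cost P gamma c s 0.
Proof.
move=> sP g01; set x := discounted_cost P gamma c.
have [g0 g1] := andP g01.
(* A uniform bound on the initial errors: their sum dominates each of them. *)
set D := \sum_s `|truncated_cost P gamma c 0 s 0 - x s 0|.
have xE s' : x s' 0 = c s' 0 + gamma * (P *m x) s' 0 by exact: discounted_costE.
have bnd N s' : `|truncated_cost P gamma c N s' 0 - x s' 0| <= gamma ^+ N * D.
  elim: N s' => [|N IH] s'.
    rewrite expr0 mul1r /D (bigD1 s') //= lerDl.
    by apply: sumr_ge0 => i _; apply: normr_ge0.
  rewrite truncated_cost_rec // xE.
  set T := truncated_cost _ _ _ _.
  have -> : c s' 0 + gamma * (P *m T) s' 0 - (c s' 0 + gamma * (P *m x) s' 0)
    = gamma * (P *m (T - x)) s' 0.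
    by rewrite mulmxBr mx_subE; ring.
  rewrite normrM ger0_norm // exprS -mulrA ler_wpM2l // ler_norml.
  rewrite lerNl; apply/andP; split.
    rewrite -mx_oppE -mulmxN; apply: stochastic_le => // j; have := IH j.
    by rewrite ler_norml mx_oppE mx_subE => /andP[]; rewrite lerNl.
  apply: stochastic_le => // j; have := IH j.
  by rewrite ler_norml mx_subE => /andP[].
have cvgg : (fun N => gamma ^+ N * D) @ \oo --> (0 : R).
  rewrite -(mul0r D); apply: cvgMl; apply: cvg_expr.
  by rewrite ger0_norm.
apply/cvgrPdist_le => e e0.
move/cvgrPdist_le : cvgg => /(_ _ e0); apply: filterS => N.
rewrite sub0r normrN => h; rewrite distrC.
exact: (le_trans (bnd N s) (le_trans (ler_norm _) h)).
Qed.

End StochasticMatrix.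

(** * The robust backup operator and Bellman inequalities *)

Section RobustBackup.
Context {R : realType} {n m : nat} (M : rmdp R n m) (gamma : R).
Hypothesis gamma01 : 0 <= gamma < 1.
Implicit Types (sigma : agent_policy n m) (tau : adversary_policy R n m).
Implicit Types (u w : 'cV[R]_n).

Let backup := robust_backup M gamma.

Lemma rV_functional_continuous u : continuous (fun p : 'rV[R]_n => (p *m u) 0 0).
Proof.
have -> : (fun p : 'rV[R]_n => (p *m u) 0 0) =
    (fun p => \sum_(j <- index_enum 'I_n) p 0 j * u j 0).
  by apply/funext => p; rewrite mxE.
elim: (index_enum _) => [|j r IH].
  have -> : (fun p : 'rV[R]_n => \sum_(j <- [::]) p 0 j * u j 0) = cst 0.
    by apply/funext => p; rewrite big_nil.
  exact: cst_continuous.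
have -> : (fun p : 'rV[R]_n => \sum_(i <- j :: r) p 0 i * u i 0) =
    (fun p => p 0 j * u j 0 + \sum_(i <- r) p 0 i * u i 0).
  by apply/funext => p; rewrite big_cons.
move=> p; have pj : (fun q : 'rV[R]_n => q 0 j) @ p --> p 0 j.
  exact: coord_continuous.
exact: (cvgD (cvgM pj (cvg_cst (u j 0))) (IH p)).
Qed.

Lemma robust_backup_max u s a : exists2 p, uncertainty M s a p &
  backup u s a = cost M s 0 + gamma * (p *m u) 0 0 /\
  forall q, uncertainty M s a q ->
    cost M s 0 + gamma * (q *m u) 0 0 <= backup u s a.
Proof.
set f := fun p : 'rV[R]_n => cost M s 0 + gamma * (p *m u) 0 0.
have cf : {within uncertainty M s a, continuous f}.
  apply: continuous_subspaceT => p.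
  have cp := @rV_functional_continuous u p.
  exact: (cvgD (cvg_cst (cost M s 0)) (cvgM (cvg_cst gamma) cp)).
have [p pU pmax] := compact_EVT_max (uncertainty_nonempty M s a)
  (@uncertainty_compact _ _ _ M s a) cf.
have {}pU : uncertainty M s a p by rewrite inE in pU.
have {}pmax q : uncertainty M s a q -> f q <= f p.
  by move=> qU; apply: pmax; rewrite inE.
have backupE : backup u s a = f p.
  apply/eqP; rewrite eq_le; apply/andP; split.
    by apply: ge_sup => [|_ [q qU <-]]; [exists (f p), p | exact: pmax].
  by apply: ub_le_sup; [exists (f p) => _ [q qU <-]; exact: pmax | exists p].
by exists p => //; split => // q qU; rewrite backupE; exact: pmax.
Qed.

(** Monotonicity ([e = 0]) and contraction in one inequality: the distribution maximal for [u]
    competes in the backup of [w], and its total mass 1 turns the shift [e] into [gamma * e]. *)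
Lemma robust_backup_shift u w e s a : 0 <= e ->
  (forall s', u s' 0 <= w s' 0 + e) ->
  backup u s a <= backup w s a + gamma * e.
Proof.
move=> e0 uw; have [g0 _] := andP gamma01.
have [p pU [-> _]] := robust_backup_max u s a.
have [_ _ [_ /(_ p pU) wmax]] := robust_backup_max w s a.
have [p0 p1 _] := uncertainty_distr pU.
suff pu : (p *m u) 0 0 <= (p *m w) 0 0 + e.
  by have := ler_wpM2l g0 pu; lra.
rewrite !mxE -[X in _ + X]mul1r -p1 mulr_suml -big_split /=.
by apply: ler_sum => j _; rewrite -mulrDr ler_wpM2l.
Qed.

Lemma le_robust_backup u w s a : (forall s', u s' 0 <= w s' 0) ->
  backup u s a <= backup w s a.
Proof.
move=> uw; have := @robust_backup_shift u w 0 s a (lexx 0).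
by rewrite mulr0 addr0; apply => s'; rewrite addr0.
Qed.

(** Apply [contraction_bound] to [u - w]. With [e = 0] this compares a subsolution with a
    supersolution. *)
Lemma robust_backup_comparison sigma u w e : 0 <= e ->
  (forall s, u s 0 <= backup u s (sigma s)) ->
  (forall s, backup w s (sigma s) <= w s 0 + e) ->
  forall s, u s 0 <= w s 0 + e / (1 - gamma).
Proof.
move=> e0 ule wge s; rewrite -lerBlDl.
apply: (@contraction_bound _ _ gamma e (fun s => u s 0 - w s 0)) => // b b0 ub s1.
have : backup u s1 (sigma s1) <= backup w s1 (sigma s1) + gamma * b.
  by apply: robust_backup_shift => // s'; rewrite -lerBlDl.
by have := ule s1; have := wge s1; lra.
Qed.

Lemma le_robust_backup_fixpoint sigma u w :
  (forall s, u s 0 <= backup u s (sigma s)) ->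
  (forall s, backup w s (sigma s) <= w s 0) ->
  forall s, u s 0 <= w s 0.
Proof.
move=> ule wge s; have := @robust_backup_comparison sigma u w 0 (lexx 0) ule.
by rewrite mul0r => /(_ _ s); rewrite addr0; apply => s'; rewrite addr0.
Qed.

Lemma robust_backup_fixpoint_uniq sigma u w :
  (forall s, u s 0 = backup u s (sigma s)) ->
  (forall s, w s 0 = backup w s (sigma s)) -> u = w.
Proof.
move=> uE wE; apply/colP => s; apply/eqP; rewrite eq_le; apply/andP; split;
  by apply: (@le_robust_backup_fixpoint sigma) => s'; rewrite ?{1}uE ?{1}wE.
Qed.

Lemma transition_mulmx sigma tau u s :
  (transition_mx sigma tau *m u) s 0 = (tau s (sigma s) *m u) 0 0.
Proof. by rewrite !mxE; apply: eq_bigr => j _; rewrite mxE. Qed.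

Lemma stochastic_transition_mx sigma tau :
  admissible M tau -> stochastic (transition_mx sigma tau).
Proof.
move=> adm; split => [s s'|s]; have [p0 p1 _] := uncertainty_distr (adm s (sigma s)).
  by rewrite mxE.
by rewrite -[RHS]p1; apply: eq_bigr => j _; rewrite mxE.
Qed.

Lemma expected_costE sigma tau s : admissible M tau ->
  expected_cost M gamma sigma tau s =
  discounted_cost (transition_mx sigma tau) gamma (cost M) s 0.
Proof.
move=> adm; have sP := stochastic_transition_mx sigma adm.
rewrite -(cvg_lim _ (@truncated_cost_cvg _ _ _ _ (cost M) s sP gamma01)) //.
by congr (limn _); apply/funext => N; rewrite mxE.
Qed.

Lemma expected_cost_le sigma tau u : admissible M tau ->
  (forall s, backup u s (sigma s) <= u s 0) ->
  forall s, expected_cost M gamma sigma tau s <= u s 0.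
Proof.
move=> adm ub s; rewrite expected_costE //.
apply: discounted_cost_le => // [|s']; first exact: stochastic_transition_mx.
rewrite transition_mulmx; apply: le_trans (ub s').
by have [_ _ [_]] := robust_backup_max u s' (sigma s'); apply.
Qed.

Lemma exists_maximizing_adversary u : exists2 tau, admissible M tau &
  forall s a, backup u s a = cost M s 0 + gamma * (tau s a *m u) 0 0.
Proof.
have H (x : 'I_n * 'I_m) : exists p, uncertainty M x.1 x.2 p /\
    backup u x.1 x.2 = cost M x.1 0 + gamma * (p *m u) 0 0.
  by have [p pU [pE _]] := robust_backup_max u x.1 x.2; exists p.
have [f fP] := choice H.
by exists (fun s a => f (s, a)) => s a; have [] := fP (s, a).
Qed.

(** For the adversary maximizing the backup of [u], [u] is a subsolution of the induced chain, hence
    below its cost. One more step of that chain raises the bound from [u] to its backup, the form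
    that [oracle_fixpoint] uses. *)
Lemma exists_costly_adversary sigma u :
  (forall s, u s 0 <= backup u s (sigma s)) ->
  exists2 tau, admissible M tau &
    forall s, backup u s (sigma s) <= expected_cost M gamma sigma tau s.
Proof.
move=> ub; have [tau adm tauE] := exists_maximizing_adversary u.
have sP := stochastic_transition_mx sigma adm.
exists tau => // s; rewrite expected_costE //.
have ule := @le_discounted_cost _ _ _ gamma (cost M) u sP gamma01.
rewrite discounted_costE // tauE lerD2l ler_wpM2l ?(andP gamma01).1 //.
rewrite -[X in X <= _](transition_mulmx sigma tau) !mxE.
apply: ler_sum => j _; rewrite ler_wpM2l ?sP.1 //.
by apply: ule => s'; rewrite transition_mulmx -tauE.
Qed.

(** The constant [K] solves [K = sum |c| + gamma * K], so it is a supersolution for every adversary.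
    Boundedness lets the [sup] in [worst_cost] dominate its members. *)
Lemma expected_cost_bounded sigma s :
  has_ubound [set expected_cost M gamma sigma tau s | tau in admissible M].
Proof.
have [g0 g1] := andP gamma01.
have g1' : 0 < 1 - gamma by rewrite subr_gt0.
set K := (\sum_s `|cost M s 0|) / (1 - gamma).
exists K => _ [tau adm <-].
have -> : K = (const_mx K : 'cV[R]_n) s 0 by rewrite mxE.
apply: expected_cost_le => // s'.
have [p pU [-> _]] := robust_backup_max (const_mx K) s' (sigma s').
have [_ p1 _] := uncertainty_distr pU.
have -> : (p *m (const_mx K : 'cV[R]_n)) 0 0 = K.
  by rewrite mxE; under eq_bigr do rewrite mxE; rewrite -mulr_suml p1 mul1r.
rewrite mxE -lerBrDr -[X in X - _]mul1r -mulrBl /K mulrC divfK ?gt_eqF //.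
rewrite (bigD1 s') //= (le_trans (ler_norm _)) // lerDl.
by apply: sumr_ge0 => i _; exact: normr_ge0.
Qed.

(** [u] is below the worst cost of every policy, by a costly adversary, and above that of [sigma],
    as a supersolution. *)
Lemma optimal_agent_of_bellman sigma u :
  (forall s a, u s 0 <= backup u s a) ->
  (forall s, backup u s (sigma s) <= u s 0) ->
  optimal_agent M gamma sigma.
Proof.
move=> ule uge.
have le_worst sigma' s : worst_cost M gamma sigma' s >= u s 0.
  have [tau adm costly] := @exists_costly_adversary sigma' u (fun s => ule s _).
  apply: (le_trans (ule s (sigma' s))); apply: (le_trans (costly s)).
  apply: ub_le_sup; last by exists tau.
  exact: expected_cost_bounded.
have worstE s : worst_cost M gamma sigma s = u s 0.
  apply/eqP; rewrite eq_le le_worst andbT.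
  have [tau adm _] := exists_maximizing_adversary u.
  apply: ge_sup => [|_ [tau' adm' <-]]; last exact: expected_cost_le.
  by exists (expected_cost M gamma sigma tau s), tau.
move=> s; rewrite worstE; apply/eqP; rewrite eq_le; apply/andP; split.
  by apply: lb_le_inf => [|_ [sigma' _ <-]]; [exists (worst_cost M gamma sigma s), sigma|].
rewrite -worstE; apply: ge_inf; last by exists sigma.
by exists (u s 0) => _ [sigma' _ <-].
Qed.

End RobustBackup.

(** * The oracle on the robust Markov chain of a fixed agent policy *)

Section FixedAgent.
Context {R : realType} {n m : nat} (M : rmdp R n m) (gamma : R).
Hypothesis gamma01 : 0 <= gamma < 1.

Lemma single_action_policy (sigma : agent_policy n 1) : sigma = [ffun=> ord0].
Proof. by apply/ffunP => s; rewrite ffunE [LHS]ord1. Qed.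

Lemma best_cost_rmc (N : rmc R n) tau s :
  best_cost N gamma tau s = expected_cost N gamma [ffun=> ord0] tau s.
Proof.
rewrite /best_cost -[RHS]inf1; congr inf; apply/seteqP; split => x /=.
  by move=> [sigma _ <-]; rewrite (single_action_policy sigma).
by move=> ->; exists [ffun=> ord0].
Qed.

Lemma value_rmc (N : rmc R n) s :
  value N gamma s = worst_cost N gamma [ffun=> ord0] s.
Proof.
rewrite /value -[RHS]inf1; congr inf; apply/seteqP; split => x /=.
  by move=> [sigma _ <-]; rewrite (single_action_policy sigma).
by move=> ->; exists [ffun=> ord0].
Qed.

(** The chain's own equation gives one inequality. Conversely, some adversary costs at least the
    backup of [v], and optimality of [tau] caps that cost by [v]. *)
Lemma oracle_fixpoint sigma tau :
  optimal_adversary (fix_agent M sigma) gamma tau ->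
  let v := discounted_cost (rmc_transition_mx tau) gamma (cost M) in
  forall s, v s 0 = robust_backup M gamma v s (sigma s).
Proof.
move=> [adm opt] v.
have sP := stochastic_transition_mx [ffun=> ord0] adm.
have vE s : v s 0 =
    expected_cost (fix_agent M sigma) gamma [ffun=> ord0] tau s.
  by rewrite expected_costE.
have v_max tau' s : admissible (fix_agent M sigma) tau' ->
    expected_cost (fix_agent M sigma) gamma [ffun=> ord0] tau' s <= v s 0.
  move=> adm'; rewrite vE -(best_cost_rmc _ tau) opt value_rmc.
  by apply: ub_le_sup; [exact: expected_cost_bounded | exists tau'].
have v_le s : v s 0 <= robust_backup (fix_agent M sigma) gamma v s ord0.
  rewrite {1}/v discounted_costE // -/v /rmc_transition_mx transition_mulmx ffunE.
  by have [_ _ [_]] := robust_backup_max (fix_agent M sigma) gamma v s ord0; apply.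
move=> s; apply/eqP; rewrite eq_le v_le /=.
have ule s' : v s' 0 <= robust_backup (fix_agent M sigma) gamma v s'
    ([ffun=> ord0] s' : 'I_1) by rewrite ffunE.
have [tau' adm' /(_ s)] := exists_costly_adversary gamma01 ule.
by rewrite ffunE => /le_trans; apply; exact: v_max.
Qed.

End FixedAgent.

(** * Monotone values along policy iteration *)

Section ValueSequence.
Context {R : realType} {n m : nat} (M : rmdp R n m) (gamma : R).
Hypothesis gamma01 : 0 <= gamma < 1.
Variables (sigma : nat -> agent_policy n m) (v : nat -> 'cV[R]_n).

Let backup := robust_backup M gamma.

Hypothesis v_fixpoint : forall t s, v t s 0 = backup (v t) s (sigma t s).
Hypothesis sigma_greedy :
  forall t s a, backup (v t) s (sigma t.+1 s) <= backup (v t) s a.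

(** One step at a time: greedy choice makes [v t] a supersolution for [sigma t.+1], whose fixed
    point is [v t.+1]. *)
Lemma value_seq_antitone t k s : v (t + k)%N s 0 <= v t s 0.
Proof.
elim: k => [|k IH]; first by rewrite addn0.
apply: le_trans IH; rewrite addnS; move: (t + k)%N => {}t.
apply: (@le_robust_backup_fixpoint _ _ _ M gamma _ (sigma t.+1)) => // s'.
  by rewrite {1}v_fixpoint.
by rewrite [leRHS]v_fixpoint.
Qed.

Lemma value_seq_step t s : v t.+1 s 0 <= backup (v t) s (sigma t.+1 s).
Proof.
rewrite v_fixpoint; apply: le_robust_backup => // s'.
by have := value_seq_antitone t 1 s'; rewrite addn1.
Qed.

Lemma value_seq_inj t t' : sigma t = sigma t' -> v t = v t'.
Proof.
move=> st; apply: (@robust_backup_fixpoint_uniq _ _ _ M gamma _ (sigma t)) => // s.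
by rewrite st.
Qed.

Lemma bellman_of_stationary t :
  v t.+1 = v t -> forall s a, v t s 0 <= backup (v t) s a.
Proof.
move=> vt s a; rewrite -{1}vt; exact: le_trans (value_seq_step _ _) (sigma_greedy _ _ _).
Qed.

(* There are finitely many policies, so some value recurs; by monotonicity the
   values are constant in between. *)
Lemma value_seq_bellman : exists t, forall s a, v t s 0 <= backup (v t) s a.
Proof.
have /injectivePn [i [j ij eqij]] :
    ~~ injectiveb (fun i : 'I_(#|{ffun 'I_n -> 'I_m}|.+1) => sigma i).
  by apply/negP => /injectiveP/leq_card; rewrite card_ord ltnn.
wlog lt_ij : i j ij eqij / (i < j)%N.
  move=> H; have [/H|/H|/val_inj/eqP] := ltngtP i j; first exact.
    by apply; rewrite // eq_sym.
  by rewrite (negPf ij).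
exists i; apply: bellman_of_stationary.
apply/colP => s; apply/eqP; rewrite eq_le; apply/andP; split.
  by have := value_seq_antitone i 1 s; rewrite addn1.
by have := value_seq_antitone i.+1 (j - i.+1) s; rewrite subnKC // -(value_seq_inj eqij).
Qed.

(** * Elimination of state-action pairs *)

Section Elimination.
Variables (w : 'cV[R]_n) (sigmaw : agent_policy n m) (K : nat).
Hypothesis w_le : forall s a, w s 0 <= backup w s a.
Hypothesis w_ge : forall s, backup w s (sigmaw s) <= w s 0.
Hypothesis K_large : gamma ^+ K < 1 - gamma.

Lemma bellman_le_value t s : w s 0 <= v t s 0.
Proof.
apply: (@le_robust_backup_fixpoint _ _ _ M gamma _ (sigma t)) => // s'.
by rewrite [leRHS]v_fixpoint.
Qed.

(** The greedy backup is at most that of the fixed policy [sigmaw], which contracts towards [w]. *)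
Lemma value_seq_contraction t k e : 0 <= e ->
  (forall s, v t s 0 <= w s 0 + e) ->
  forall s, v (t + k)%N s 0 <= w s 0 + gamma ^+ k * e.
Proof.
have [g0 _] := andP gamma01.
move=> e0 vw; elim: k => [|k IH] s; first by rewrite addn0 expr0 mul1r.
rewrite addnS; apply: le_trans (value_seq_step _ _) _.
apply: le_trans (sigma_greedy _ _ (sigmaw s)) _.
have ge0 : 0 <= gamma ^+ k * e by rewrite mulr_ge0 // exprn_ge0.
have := @robust_backup_shift _ _ _ M _ gamma01 _ _ _ s (sigmaw s) ge0 IH.
by have := w_ge s; rewrite /backup exprS; lra.
Qed.

Lemma action_eliminated t : v t <> w ->
  exists s, forall k, (K <= k)%N -> sigma (t + k)%N s <> sigma t s.
Proof.
have [g0 g1] := andP gamma01; have g1' : 0 < 1 - gamma by rewrite subr_gt0.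
(* A maximum over states needs one state; without any, [v t] and [w] would be equal. *)
move=> vw; have [s0 _] : exists s : 'I_n, True.
  apply: contrapT => nos; apply: vw; apply/colP => s; exfalso; apply: nos.
  by exists s.
pose d s := backup w s (sigma t s) - w s 0.
case: (@arg_maxP _ _ _ s0 xpredT d isT) => {s0}s _ d_max.
have d_ge0 : 0 <= d s by rewrite subr_ge0.
have vt_le : forall s', v t s' 0 <= w s' 0 + d s / (1 - gamma).
  apply: (@robust_backup_comparison _ _ _ M gamma _ (sigma t)) => // s'.
    by rewrite {1}v_fixpoint.
  by rewrite -lerBlDl; exact: d_max.
(* If the maximal gap vanished, [vt_le] would squeeze [v t] onto [w]. *)
have d_gt0 : 0 < d s.
  rewrite lt0r d_ge0 andbT; apply/eqP => d0; apply: vw; apply/colP => s'.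
  apply/eqP; rewrite eq_le bellman_le_value andbT.
  by have := vt_le s'; rewrite d0 mul0r addr0.
exists s => k Kk same.
have := value_seq_contraction k (divr_ge0 d_ge0 (ltW g1')) vt_le s.
(* Were the action repeated, [d s] would be at most [gamma ^+ k / (1 - gamma) * d s]; cancelling
   [d s] contradicts [K_large]. *)
have : backup w s (sigma t s) <= v (t + k)%N s 0.
  rewrite -same [leRHS]v_fixpoint; apply: le_robust_backup => // s'.
  exact: bellman_le_value.
move=> /le_trans/[apply]; rewrite -lerBlDl -/(d s) mulrA ler_pdivlMr //.
rewrite mulrC ler_pM2r // leNgt => /negP; apply.
by apply: le_lt_trans K_large; rewrite ler_wiXn2l // ltW.
Qed.

(** Otherwise each time [j * K] with [j <= n * m] eliminates a pair. Two of these [n * m + 1] pairs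
    coincide, yet the later time is at least [K] steps after the earlier one. *)
Lemma value_seq_reaches : exists2 t, (t <= n * m * K)%N & v t = w.
Proof.
apply: contrapT => never.
have H (j : 'I_(n * m).+1) : exists s, forall k, (K <= k)%N ->
    sigma (j * K + k)%N s <> sigma (j * K)%N s.
  apply: action_eliminated => vw; apply: never; exists (j * K)%N => //.
  by rewrite leq_mul2r -ltnS ltn_ord orbT.
have [f fP] := choice H.
have /injectivePn [i [j ij [fij sij]]] :
    ~~ injectiveb (fun j : 'I_(n * m).+1 => (f j, sigma (j * K)%N (f j))).
  by apply/negP => /injectiveP/leq_card; rewrite card_prod !card_ord ltnn.
wlog lt_ij : i j ij fij sij / (i < j)%N.
  move=> H'; have [/H'|/H'|/val_inj/eqP] := ltngtP i j; first exact.
    by apply; rewrite // eq_sym.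
  by rewrite (negPf ij).
apply: (fP i ((j - i) * K)%N).
  by rewrite leq_pmull // subn_gt0.
by rewrite -mulnDl subnKC ?(ltnW lt_ij) // sij fij.
Qed.

End Elimination.
End ValueSequence.

(** * Length of an elimination round and the iteration bound *)

Lemma exists_power_lt (R : realType) (gamma : R) : 0 <= gamma < 1 ->
  exists2 K : nat, gamma ^+ K < 1 - gamma &
    K%:R <= 2 * Num.max 1 (ln (1 - gamma) / ln gamma).
Proof.
move=> /andP[g0 g1]; set x := ln (1 - gamma) / ln gamma.
(* At [gamma = 0] the quotient [x] rests on a default value of [ln]; there [K = 1] works, the
   maximum being at least 1. *)
have [->|gN0] := eqVneq gamma 0.
  exists 1%N; first by rewrite expr1 subr0 ltr01.
  have : 1 <= Num.max 1 x by rewrite le_max lexx.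
  lra.
have gp : 0 < gamma by rewrite lt0r gN0.
have lng : ln gamma < 0 by rewrite ln_lt0 // gp.
have x0 : 0 <= x.
  by rewrite /x ler_ndivlMr // mul0r ln_le0 // gerBl.
(* This is the first integer above [x]; as [ln gamma < 0], exceeding [x] means
   [gamma ^+ K < 1 - gamma]. *)
exists (Num.truncn x).+1.
  rewrite -ltr_ln ?posrE ?exprn_gt0 ?subr_gt0 // lnXn // -mulr_natl.
  by rewrite -ltr_ndivrMr // truncnS_gt.
have xK : (Num.truncn x)%:R <= x by rewrite truncn_le.
have : 1 <= Num.max 1 x by rewrite le_max lexx.
have : x <= Num.max 1 x by rewrite le_max lexx orbT.
by rewrite -natr1; lra.
Qed.

Lemma greedy_actions_neq0 (R : realType) (n m : nat) (M : rmdp R n m) gamma v s :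
  (0 < m)%N -> greedy_actions M gamma v s != finset.set0.
Proof.
move=> m0; pose a0 : 'I_m := Ordinal m0.
case: (@arg_minP _ _ _ a0 xpredT (robust_backup M gamma v s) isT) => a _ amin.
by apply/set0Pn; exists a; rewrite inE; apply/forallP => b; exact: amin.
Qed.

(* The factor log(1-gamma)/log(gamma) tends to 0 as gamma tends to 0, whereas
   at least one iteration is always performed: the O() is read with this factor
   bounded below by 1, i.e. unchanged for gamma >= 1/2. *)
Theorem theorem1 (R : realType) :
  exists C : R, forall (n m : nat) (M : rmdp R n m) (gamma : R)
    (pick : 'I_n -> 'I_m -> {set 'I_m} -> 'I_m)
    (sigma : nat -> agent_policy n m)
    (tau : nat -> adversary_policy R n 1)
    (v : nat -> 'cV[R]_n),
  (0 < n)%N -> (0 < m)%N -> 0 <= gamma < 1 ->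
  tie_breaking pick ->
  policy_iteration M gamma pick sigma tau v ->
  exists T : nat,
    [/\ stops_after sigma T,
        optimal_agent M gamma (sigma T) &
        T%:R <= C * n%:R * m%:R * Num.max 1 (ln (1 - gamma) / ln gamma)].
Proof.
(* With [x] the maximum in the bound, [T <= n * m * K + 2] and [K <= 2 * x], while [1 <= n * m * x]
   absorbs the 2. *)
exists 4 => n m M gamma pick sigma tau v n0 m0 g01 tie [oracle eval improve].
have v_fixpoint t s : v t s 0 = robust_backup M gamma (v t) s (sigma t s).
  by rewrite eval; exact: oracle_fixpoint.
have in_greedy t s : sigma t.+1 s \in greedy_actions M gamma (v t) s.
  rewrite improve.
  by have [] := tie s (sigma t s) _ (greedy_actions_neq0 M gamma (v t) s m0).
have sigma_greedy t s a : robust_backup M gamma (v t) s (sigma t.+1 s) <=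
    robust_backup M gamma (v t) s a.
  by have := in_greedy t s; rewrite inE => /forallP.
(* A Bellman solution found along the run itself serves as [w], with [sigma L] attaining it. *)
have [L bellL] := value_seq_bellman g01 v_fixpoint sigma_greedy.
have bellL_ge s : robust_backup M gamma (v L) s (sigma L s) <= v L s 0.
  by rewrite [leRHS]v_fixpoint.
have [K K_large K_small] := exists_power_lt g01.
have [t t_le vt] :=
  value_seq_reaches g01 v_fixpoint sigma_greedy bellL bellL_ge K_large.
have vt1 : v t.+1 = v t.
  apply/colP => s; apply/eqP; rewrite eq_le; apply/andP; split.
    have := value_seq_antitone g01 v_fixpoint sigma_greedy t 1 s.
    by rewrite addn1.
  by rewrite vt; exact: (bellman_le_value g01 v_fixpoint bellL).
(* The policy may still change at [t.+1]; then the set of minimizers repeats, and the second clause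
   of [tie_breaking] repeats the choice. *)
have sigma_stationary : sigma t.+2 = sigma t.+1.
  apply/ffunP => s; rewrite improve vt1 improve.
  by have [] := tie s (sigma t s) _ (greedy_actions_neq0 M gamma (v t) s m0).
have exT : exists T, (0 < T)%N && (sigma T == sigma T.-1).
  by exists t.+2; rewrite /= sigma_stationary.
case: (ex_minnP exT) => T /andP[T0 /eqP sT] T_min; exists T; split.
- split => // k /andP[k0 kT] sk.
  by have := T_min k; rewrite k0 sk eqxx leqNgt kT => /(_ isT).
(* The exit may come before [t.+2], so optimality is read off the exit test: [sigma T] is greedy for
   its own fixed point [v T.-1]. *)
- have vT s : v T.-1 s 0 = robust_backup M gamma (v T.-1) s (sigma T s).
    by rewrite sT; exact: v_fixpoint.
  apply: (@optimal_agent_of_bellman _ _ _ _ _ g01 _ (v T.-1)) => [s a|s].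
    by rewrite vT; have := sigma_greedy T.-1 s a; rewrite (prednK T0).
  by rewrite [leRHS]vT.
have T_le : (T <= n * m * K + 2)%N.
  have /T_min : (0 < t.+2)%N && (sigma t.+2 == sigma t.+1).
    by rewrite sigma_stationary eqxx.
  by move=> /leq_trans; apply; rewrite addn2 !ltnS.
set x := Num.max _ _ in K_small *.
have x1 : 1 <= x by rewrite le_max lexx.
have nm1 : 1 <= (n * m)%:R :> R by rewrite ler1n muln_gt0 n0.
have : T%:R <= (n * m)%:R * K%:R + 2 :> R by rewrite -natrM -natrD ler_nat.
rewrite -(mulrA 4) -natrM; set N : R := (n * m)%:R in nm1 *.
have : N * K%:R <= N * (2 * x) by rewrite ler_wpM2l // (le_trans ler01).
have : 1 <= N * x by rewrite -[leLHS]mulr1 ler_pM.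
by lra.
Qed.
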